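(* Let $\Sigma\subset\mathbb{C}$ be an unbounded closed set, $t>0$, and $Q$ a weakly admissible external field on $\Sigma$ for the mass $t$, with equilibrium measure $\mu_Q$ (of mass $t$). Assume $\mu$ is a positive measure of mass $t$ supported on $\Sigma$, with finite energy $I(\mu)$, and that there exists a finite constant $C$ such that $$V^{\mu}(z)+Q(z)\ge C\quad\text{q.e. on }\Sigma,$$ $$V^{\mu}(z)+Q(z)\le C\quad\text{q.e. on }\operatorname{supp}\mu.$$ Then $\mu=\mu_Q$.
   Context: $V^{\sigma}(z)=-\int\log|z-y|\,d\sigma(y)$ is the logarithmic potential and $I(\sigma)=-\iint\log|x-y|\,d\sigma(x)d\sigma(y)$ the logarithmic energy of a measure $\sigma$. ''q.e.'' (quasi-everywhere) means outside of a set of logarithmic capacity $0$. $Q$ is weakly admissible on $\Sigma$ for the mass $t$ if: (i) $Q:\Sigma\to(-\infty,+\infty]$ is lower semi-continuous; (ii) $\{x\in\Sigma: Q(x)<+\infty\}$ has positive logarithmic capacity; (iii) $\liminf_{|x|\to\infty,\,x\in\Sigma}(Q(x)-t\log|x|)=M$ for some $M\in(-\infty,\infty]$. The equilibrium measure $\mu_Q$ is the unique positive measure of mass $t$ on $\Sigma$ minimizing $$I_Q(\sigma)=\iint\left(\log\frac1{|x-y|}+\frac{Q(x)}t+\frac{Q(y)}t\right)d\sigma(x)d\sigma(y)$$ among positive measures $\sigma$ of mass $t$ on $\Sigma$ (existence, uniqueness, and finiteness of $I_Q(\mu_Q)$ and $I(\mu_Q)$ are known). *)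

(* Defs.v *)
From HB Require Import structures.
From mathcomp Require Import all_boot all_order all_algebra complex.
From mathcomp Require Import all_classical all_reals all_analysis.

Set Implicit Arguments.
Unset Strict Implicit.
Unset Printing Implicit Defensive.

Import Order.TTheory GRing.Theory Num.Theory.
Import numFieldNormedType.Exports.
Export numFieldNormedType.Exports.

Local Open Scope classical_set_scope.
Local Open Scope ring_scope.
Local Open Scope ereal_scope.

(* R[i] as a numClosedFieldType, so that it gets the topology of the modulus. *)
Definition Cplx (R : realType) : numClosedFieldType := (R[i])%C.

(* Carrier of the Borel sigma-algebra: it is convertible to Cplx R. *)
Notation borelC R := (g_sigma_algebraType (@open (Cplx R))).

(* A positive measure of mass t is finite, so Borel measures on the plane are
   taken in this type. *)
Notation fmeasC R := {finite_measure set (borelC R) -> \bar R}.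

Section potential_theory.
Context {R : realType}.
Implicit Types (mu sigma : fmeasC R) (Sigma E : set (Cplx R)).
Implicit Types (Q : Cplx R -> \bar R) (z : Cplx R) (t : R).

(* The R-valued modulus (the norm `|z| of R[i] takes its values in R[i]). *)
Definition cabs z : R := ComplexField.Normc.normc z.

(* lne is the extended logarithm: log|x - y| = -oo when x = y. *)
Definition log_dist (x y : Cplx R) : \bar R := lne (cabs (x - y))%:E.

Definition log_potential mu z : \bar R := - \int[mu]_y log_dist z y.

(* If both the positive and the negative parts of the integrand have infinite
   integral, the library's integral is -oo; hence the energy is a finite number
   only when log|x - y| is integrable for the product measure. *)
Definition log_energy mu : \bar R := - \int[mu \x mu]_p log_dist p.1 p.2.

Definition measure_support mu : set (Cplx R) :=
  [set z | forall U : set (Cplx R), open_nbhs z U -> 0 < mu U].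

Definition log_capacity E : \bar R :=
  expeR (- ereal_inf [set log_energy sigma | sigma in
    [set sigma : fmeasC R | [/\ sigma setT = 1,
       compact (measure_support sigma) & measure_support sigma `<=` E]]]).

Definition quasi_everywhere E (P : Cplx R -> Prop) : Prop :=
  exists2 N : set (Cplx R), log_capacity N = 0 & forall z, E z -> ~ N z -> P z.

Definition complex_infty : set_system (Cplx R) :=
  filter_from setT (fun r : R => [set z | (r < cabs z)%R]).

(* An external field on Sigma is a function on the whole plane of which only the
   values on Sigma matter. *)
Definition weakly_admissible t Sigma Q : Prop :=
  [/\ forall z, Sigma z -> -oo < Q z,
      lower_semicontinuous (Q : subspace Sigma -> \bar R),
      0 < log_capacity [set z | Sigma z /\ Q z < +oo] &
      -oo < limf_einf (fun z => Q z - (t * ln (cabs z))%:E)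
              (within Sigma complex_infty)].

Definition mass_on t Sigma mu : Prop :=
  mu setT = t%:E /\ measure_support mu `<=` Sigma.

(* The domain of integration is Sigma `*` Sigma, which carries all the mass when
   mu lives on the closed set Sigma, because Q has no meaning outside Sigma. *)
Definition weighted_energy t Sigma Q mu : \bar R :=
  \int[mu \x mu]_(p in Sigma `*` Sigma)
     (- log_dist p.1 p.2 + Q p.1 * (t^-1)%:E + Q p.2 * (t^-1)%:E).

Definition minimizes_weighted_energy t Sigma Q mu : Prop :=
  mass_on t Sigma mu /\
  forall sigma, mass_on t Sigma sigma ->
    weighted_energy t Sigma Q mu <= weighted_energy t Sigma Q sigma.

(* Equality of measures is equality on Borel sets: a term of the measure type
   also has (irrelevant) values on the other sets. *)
Definition same_measure (mu nu : fmeasC R) : Prop :=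
  forall A : set (borelC R), measurable A -> mu A = nu A.

Definition equilibrium_measure t Sigma Q mu : Prop :=
  minimizes_weighted_energy t Sigma Q mu /\
  forall sigma, minimizes_weighted_energy t Sigma Q sigma -> same_measure sigma mu.

End potential_theory.

(* Main.v *)
Require Import Defs.
From mathcomp Require Import all_boot all_order all_algebra complex.
From mathcomp Require Import all_classical all_reals all_analysis.
From mathcomp Require Import measurable_realfun ring lra.

(** Potential theory is transported to the Riemann sphere. Put
    [L x = log (1 + |x|^2) / 2]. The kernel
    [K x y = - log |x - y| + L x + L y] is minus the logarithm of the chordal
    distance of the stereographic projections of [x] and [y]; it takes values
    in [0, +oo], so that no integral against it is ever undefined. With
    [q = Q / t - L + b] on [Sigma], where weak admissibility provides a constant
    [b] that makes [q] nonnegative, the weighted energy of a measure [s] of mass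
    [t] on [Sigma] is
    [E s s + 2 t (int q ds) - 2 b t^2] with [E s m = int int K dm ds]
    ([weighted_energyE]).

    A competitor [s] of finite weighted energy has finite spherical energy,
    although [log |x|] need not be integrable for it, so its logarithmic energy
    is never used. The hypotheses on [mu] say that
    [U + t q], where [U] is the potential of [mu] for [K], is at least a
    constant [c] quasi-everywhere on [Sigma] and at most [c] quasi-everywhere
    on the support of [mu]; measures of finite spherical energy do not charge
    Borel sets of capacity zero ([polar_null]), so integrating gives
      [E mu mu + t (int q dmu) <= c t <= E s mu + t (int q ds)].
    Since [K] is a positive definite kernel,
    [2 E s mu <= E mu mu + E s s] ([spherical_energy_le]), and adding up shows
    that the weighted energy of [mu] is at most that of [s]. So [mu] is a
    minimizer, and it is [muQ] by uniqueness of the equilibrium measure.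

    Positive definiteness is elementary on the sphere. If
    [u = 1 - |x - y|^2 / ((1 + |x|^2) (1 + |y|^2))], then
    [K = - log (1 - u) / 2 = (1/2) sum_n u^n / n], a series with nonnegative
    terms, and [u] is a finite sum of products [g x * g y] of bounded functions
    [g]; products of such kernels are again of this form, and for them the
    inequality is [2 a b <= a^2 + b^2] for the integrals of the [g]. *)

Set Implicit Arguments.
Unset Strict Implicit.
Unset Printing Implicit Defensive.
Import Order.TTheory GRing.Theory Num.Theory.
Local Open Scope classical_set_scope.
Local Open Scope ring_scope.

(** * Topology of the plane *)

Section plane_topology.
Context {R : realType}.
Implicit Types z w : Cplx R.

Definition re (z : Cplx R) : R := complex.Re z.
Definition im (z : Cplx R) : R := complex.Im z.

Lemma cabsE z : cabs z = Num.sqrt (re z ^+ 2 + im z ^+ 2).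
Proof. by case: z. Qed.

Lemma sqr_cabs z : cabs z ^+ 2 = re z ^+ 2 + im z ^+ 2.
Proof. by rewrite cabsE sqr_sqrtr// addr_ge0 ?sqr_ge0. Qed.

Lemma reB z w : re (z - w) = re z - re w.
Proof. by rewrite /re raddfB. Qed.

Lemma imB z w : im (z - w) = im z - im w.
Proof. by rewrite /im raddfB. Qed.

Lemma cabs_ge0 z : 0 <= cabs z.
Proof. by rewrite cabsE sqrtr_ge0. Qed.

Lemma cabs0 : cabs (0 : Cplx R) = 0.
Proof. exact: ComplexField.Normc.normc0. Qed.

Lemma cabsB z w : cabs (z - w) = cabs (w - z).
Proof. by rewrite -opprB /cabs normcN. Qed.

Lemma ler_cabsD (x y z : Cplx R) : cabs (x - z) <= cabs (x - y) + cabs (y - z).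
Proof.
have -> : x - z = (x - y) + (y - z) by rewrite addrA subrK.
exact: le_normcD.
Qed.

(** The topology of the plane is given by balls whose radii are complex numbers
    (positive, hence real); this restates it with real radii. *)
Lemma nbhs_cabs z (U : set (Cplx R)) :
  nbhs z U <-> exists2 e : R, 0 < e & forall w, cabs (z - w) < e -> U w.
Proof.
split => [/nbhs_ballP[e /= e0 eU]|[e e0 eU]]; last apply/nbhs_ballP.
  exists (re e).
    by move: e0; rewrite ltcE /= => /andP[].
  move=> w zw; apply: eU; rewrite /ball /= ltcE /=.
  by move: e0; rewrite ltcE /= => /andP[/eqP<-] _; rewrite eqxx.
exists (e%:C)%C; first by rewrite /= ltcR.
by move=> w; rewrite /ball /= ltcR => /eU.
Qed.

Lemma continuous_re : continuous (re : Cplx R -> R).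
Proof.
move=> z U /nbhs_ballP[e /= e0 eU]; apply/nbhs_cabs.
exists e => // w zw; apply: eU; apply: le_lt_trans zw.
by rewrite cabsE -sqrtr_sqr ler_wsqrtr// reB lerDl sqr_ge0.
Qed.

Lemma continuous_im : continuous (im : Cplx R -> R).
Proof.
move=> z U /nbhs_ballP[e /= e0 eU]; apply/nbhs_cabs.
exists e => // w zw; apply: eU; apply: le_lt_trans zw.
by rewrite cabsE -sqrtr_sqr ler_wsqrtr// imB lerDr sqr_ge0.
Qed.

Lemma hausdorff_Cplx : hausdorff_space (Cplx R).
Proof. exact: norm_hausdorff. Qed.

Definition square (n : nat) : set (Cplx R) :=
  [set z | `|re z| <= n%:R /\ `|im z| <= n%:R].

Lemma square_compact n : compact (square n).
Proof.
pose f (p : R * R) : Cplx R := (p.1 +i* p.2)%C.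
have -> : square n = f @` (`[- n%:R, n%:R] `*` `[- n%:R, n%:R]).
  apply/seteqP; split => [[a b] /= []|].
    by rewrite /square /= /re/= /im/= => ha hb; exists (a, b) => //=;
      rewrite !in_itv/= -!ler_norml.
  by move=> _ [[a b] /=] + <-; rewrite !in_itv/= -!ler_norml.
apply: continuous_compact; last by apply: compact_setX; exact: segment_compact.
apply: continuous_subspaceT => -[a b] U /nbhs_cabs[e e0 eU].
exists (ball a (e / 2), ball b (e / 2)).
  by split; apply: nbhsx_ballx; rewrite divr_gt0.
move=> [c d] [/= ac bd]; apply: eU.
apply: (@le_lt_trans _ _ (`|a - c| + `|b - d|)); last first.
  by rewrite [e]splitr ltrD.
rewrite -[leRHS]ger0_norm ?addr_ge0// -sqrtr_sqr cabsE ler_wsqrtr//.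
rewrite reB imB /re /im /= -(real_normK (num_real (b - d))).
rewrite -(real_normK (num_real (a - c))).
by have := mulr_ge0 (normr_ge0 (a - c)) (normr_ge0 (b - d)); nra.
Qed.

Lemma square_cover : \bigcup_n square n = setT.
Proof.
apply/seteqP; split => // z _; exists (Num.truncn (`|re z| + `|im z|)).+1 => //.
by split; rewrite ltW// (le_lt_trans _ (truncnS_gt _))// ?lerDl ?lerDr.
Qed.

(** The compact exhaustion consists of the points of a square whose distance to
    the complement of [U] is at least [1 / (n + 1)]. *)
Lemma open_sigma_compact (U : set (Cplx R)) : open U ->
  exists2 K : nat -> set (Cplx R), forall n, compact (K n) & U = \bigcup_n K n.
Proof.
move=> oU; pose F n : set (Cplx R) :=
  [set z | forall w, ~ U w -> n.+1%:R^-1 <= cabs (z - w)].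
have cF n : closed (F n).
  rewrite -openC openE => z /= /existsNP[w /not_implyP[Uw /negP]].
  rewrite -ltNge => zw; apply/nbhs_cabs.
  exists (n.+1%:R^-1 - cabs (z - w)); first by rewrite subr_gt0.
  move=> v vz /(_ _ Uw); apply/negP; rewrite -ltNge.
  by rewrite (le_lt_trans (ler_cabsD _ z _))// cabsB -ltrBrDr.
have FU n z : F n z -> U z.
  move=> Fz; apply: contrapT => /Fz; rewrite subrr cabs0.
  by apply/negP; rewrite -ltNge invr_gt0.
exists (fun n => F n `&` square n).
  move=> n; rewrite setIC; apply: compact_closedI => //.
  exact: square_compact.
apply/seteqP; split => [z Uz|z [n _ [+ _]]]; last exact: FU.
have /nbhs_cabs[e e0 eU] : nbhs z U by exact: open_nbhs_nbhs.
have [N] : exists N : nat, square N z.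
  by have : setT z by []; rewrite -square_cover => -[N _ ?]; exists N.
move=> [Nr Ni].
exists (maxn N (Num.truncn e^-1)) => //; split.
  move=> w /= Uw; rewrite leNgt; apply/negP => zw; apply: Uw; apply: eU.
  apply: (lt_le_trans zw); rewrite invf_ple ?posrE//.
  apply/ltW; rewrite (lt_le_trans (truncnS_gt _))// ler_nat ltnS.
  exact: leq_maxr.
by split; [apply: (le_trans Nr)|apply: (le_trans Ni)];
  rewrite ler_nat leq_maxl.
Qed.

End plane_topology.

(** * Finite Borel measures on the plane *)

Section finite_measure_tail.
Local Open Scope ereal_scope.
Context d (T : measurableType d) (R : realType).
Variable mu : {finite_measure set T -> \bar R}.

(** Continuity from above along the tails, which decrease to the empty set. *)
Lemma bigcup_tail_lt (A : (set T)^nat) (e : R) :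
  (forall n, measurable (A n)) -> (0 < e)%R ->
  exists n, mu (\bigcup_i A i `\` \bigcup_(i < n) A i) < e%:E.
Proof.
move=> mA e0; pose D n := \bigcup_i A i `\` \bigcup_(i < n) A i.
have mD n : measurable (D n).
  by apply: measurableD; apply: bigcup_measurable.
have D0 : \bigcap_n D n = set0.
  apply/seteqP; split => // x Dx; have [[i _ Ai] _] := Dx 0%N I.
  by have [_] := Dx i.+1 I; apply; exists i => //=.
have : mu \o D @ \oo --> mu (\bigcap_n D n).
  apply: nonincreasing_cvg_mu => //.
  - by rewrite ltey_eq fin_num_measure.
  - by rewrite D0.
  - move=> m n mn; apply/subsetPset => x [Ax nx]; split => // -[i /= im Ai].
    by apply: nx; exists i => //=; exact: leq_trans im mn.
rewrite D0 measure0 => /fine_cvgP[_ /cvgrPdist_lt/(_ e e0)[n _ /(_ n (leqnn n))]].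
rewrite /= sub0r normrN ger0_norm ?fine_ge0// => h; exists n.
by rewrite -(fineK (fin_num_measure mu _ (mD n))) lte_fin.
Qed.

End finite_measure_tail.

Section borel_measures.
Local Open Scope ereal_scope.
Context {R : realType}.
Variable mu : fmeasC R.

Lemma open_borel (U : set (Cplx R)) : open U -> measurable (U : set (borelC R)).
Proof. by move=> oU; apply: sub_sigma_algebra. Qed.

Lemma closed_borel (F : set (Cplx R)) :
  closed F -> measurable (F : set (borelC R)).
Proof.
by rewrite -openC => /open_borel/measurableC; rewrite setCK.
Qed.

Lemma compact_borel (K : set (Cplx R)) :
  compact K -> measurable (K : set (borelC R)).
Proof.
by move=> cK; apply: closed_borel; apply: (compact_closed hausdorff_Cplx).
Qed.

Let squeezed (A : set (Cplx R)) (e : R) := exists F U : set (Cplx R),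
  [/\ closed F, open U, F `<=` A, A `<=` U & mu (U `\` F) <= e%:E].

Lemma closed_bigcup_lt (F : nat -> set (Cplx R)) n :
  (forall i, closed (F i)) -> closed (\bigcup_(i < n) F i).
Proof. by move=> cF; rewrite bigcup_mkord; exact: closed_bigsetU. Qed.

(** The sets squeezed between a closed and an open set form a sigma-algebra;
    it contains the open sets because these are countable unions of compacts. *)
Lemma borel_squeezed (B : set (borelC R)) :
  measurable B -> forall e : R, (0 < e)%R -> squeezed B e.
Proof.
pose G : set (set (Cplx R)) :=
  [set A | forall e : R, (0 < e)%R -> squeezed A e].
suff sG : <<s @open (Cplx R) >> `<=` G by move=> mA; exact: sG mA.
apply: smallest_sub; last first.
  move=> U oU e e0.
  have [K cK UK] := open_sigma_compact oU.
  have [n nK] := bigcup_tail_lt mu (fun n => compact_borel (cK n)) e0.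
  exists (\bigcup_(i < n) K i), U; split => //.
  - apply: closed_bigcup_lt => i.
    by apply: (compact_closed hausdorff_Cplx).
  - by rewrite UK => x [i _ Kx]; exists i.
  - by rewrite {1}UK ltW.
split.
- move=> e e0; exists set0, set0; split; [exact: closed0|exact: open0|by []|by []|].
  by rewrite setD0 measure0 lee_fin ltW.
- move=> A GA e e0; have [F [U [cF oU FA AU UF]]] := GA _ e0.
  exists (~` U), (~` F); split.
  + by rewrite closedC.
  + by rewrite openC.
  + by rewrite setTD; exact: subsetC.
  + by rewrite setTD; exact: subsetC.
  + by rewrite setDE setCK setIC -setDE.
- move=> A GA e e0.
  have e2 : (0 < e / 2)%R by rewrite divr_gt0.
  have /choice[F /choice[U FU]] n := GA n _ (divr_gt0 e2 (exprn_gt0 n.+1 (ltr0Sn R 1))).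
  have mF n : measurable (F n : set (borelC R)).
    by have [? _ _ _ _] := FU n; exact: closed_borel.
  have mU n : measurable (U n : set (borelC R)).
    by have [_ ? _ _ _] := FU n; exact: open_borel.
  have [n nF] := bigcup_tail_lt mu mF e2.
  exists (\bigcup_(i < n) F i), (\bigcup_i U i); split.
  + by apply: closed_bigcup_lt => i; have [] := FU i.
  + by apply: bigcup_open => i _; have [] := FU i.
  + move=> x [i _ Fx]; exists i => //.
    by have [_ _ FA _ _] := FU i; exact: FA.
  + move=> x [i _ Ax]; exists i => //.
    by have [_ _ _ AU _] := FU i; exact: AU.
  + apply: (@le_trans _ _ (mu (\bigcup_i (U i `\` F i)) +
        mu (\bigcup_i F i `\` \bigcup_(i < n) F i))).
      apply: (le_trans _ (measureU2 mu _ _)) => //.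
      * apply: le_measure; rewrite ?inE.
        - by apply: measurableD; apply: bigcup_measurable.
        - apply: measurableU; first by apply: bigcup_measurable => i _; exact: measurableD.
          by apply: measurableD; apply: bigcup_measurable.
        - move=> x [[i _ Ux] nFx].
          have [[j _ Fj]|nF'] := pselect ((\bigcup_i F i) x).
            by right; split => //; exists j.
          by left; exists i => //; split => // Fi; apply: nF'; exists i.
      * by apply: bigcup_measurable => i _; exact: measurableD.
      * by apply: measurableD; apply: bigcup_measurable.
    rewrite [e]splitr EFinD leeD//; last exact: ltW.
    apply: (@le_trans _ _ (\sum_(i <oo) mu (U i `\` F i))).
      apply: measure_sigma_subadditive => //.
        by move=> i; exact: measurableD.
      by apply: bigcup_measurable => i _; exact: measurableD.
    apply: le_trans (epsilon_trick0 xpredT (ltW e2)).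
    apply: lee_nneseries => // i _; have [_ _ _ _ h] := FU i.
    by rewrite natrX.
Qed.

(** Inner regularity in the form that fits capacities, which are tested by
    measures with compact support only. *)
Lemma inner_compact_null (A : set (borelC R)) : measurable A ->
  (forall K : set (Cplx R), compact K -> K `<=` A -> mu K = 0) -> mu A = 0.
Proof.
move=> mA K0; apply/eqP; rewrite -measure_le0; apply/lee_addgt0Pr => e e0.
have [F [U [cF oU FA AU UF]]] := borel_squeezed mA e0.
have mF := closed_borel cF; have mU := open_borel oU.
suff F0 : mu F = 0.
  rewrite add0e; apply: le_trans UF.
  apply: (@le_trans _ _ (mu (F `|` (U `\` F)))).
    apply: le_measure; rewrite ?inE//.
      by apply: measurableU => //; exact: measurableD.
    by move=> x /AU Ux; have [|] := pselect (F x); [left|right].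
  have : mu (F `|` (U `\` F)) <= mu F + mu (U `\` F).
    by apply: measureU2 => //; exact: measurableD.
  by rewrite F0 add0e.
apply/negligibleP => //.
have -> : F = \bigcup_n (F `&` square n).
  by rewrite -setI_bigcupr square_cover setIT.
apply: negligible_bigcup => n.
have cK : compact (F `&` square n).
  by rewrite setIC; apply: compact_closedI => //; exact: square_compact.
apply/negligibleP; first exact: compact_borel.
by apply: K0 => // x [/FA].
Qed.

(** A compact subset of [U] is covered by finitely many null open sets. *)
Lemma locally_null_null (U : set (Cplx R)) : open U ->
  (forall z, U z -> exists2 V : set (Cplx R), open_nbhs z V & mu V = 0) ->
  mu U = 0.
Proof.
move=> oU locU; apply: inner_compact_null; first exact: open_borel.
move=> K cK KU; apply/negligibleP; first exact: compact_borel.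
move: cK; rewrite compact_cover => /(_ _ [set V : set (Cplx R) | open V /\ mu V = 0] id).
case=> [V []//|z /KU/locU[V [oV Vz] V0]|D' D'D KD']; first by exists V.
apply: (@negligibleS _ (borelC R) R mu _ K KD'); rewrite /cover bigcup_fset.
rewrite big_seq; elim/big_ind : _ => //.
- exact: negligible_set0.
- by move=> A B; exact: negligibleU.
- move=> V /D'D; rewrite inE => -[oV V0].
  by apply/negligibleP => //; exact: open_borel.
Qed.

Lemma closed_support : closed (measure_support mu).
Proof.
rewrite -openC openE => z /= /existsNP[U /not_implyP[[oU Uz] U0]].
rewrite /interior nbhsE; exists U => // w Uw /(_ U); apply: contra_not U0.
by apply.
Qed.

Lemma mass_off_support : mu (~` measure_support mu) = 0.
Proof.
apply: locally_null_null; first by rewrite openC; exact: closed_support.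
move=> z /= /existsNP[U /not_implyP[zU /negP U0]]; exists U => //.
by apply/eqP; rewrite -measure_le0 leNgt.
Qed.

Lemma mass_off_closed (F : set (Cplx R)) :
  closed F -> measure_support mu `<=` F -> mu (~` F) = 0.
Proof.
move=> cF suF; apply: (@subset_measure0 _ _ _ mu _ (~` measure_support mu)).
- by apply: open_borel; rewrite openC.
- by apply: open_borel; rewrite openC; exact: closed_support.
- exact: subsetC.
- exact: mass_off_support.
Qed.

End borel_measures.

(** * The Mercator series *)

Section mercator.
Context {R : realType}.

Let mercator_sum n (x : R) := \sum_(k < n) x ^+ k.+1 / k.+1%:R.

(** The derivative of the remainder of the Mercator series is the remainder
    of the geometric series. *)
Lemma is_derive_mercator_rem n (x : R) : x < 1 ->
  is_derive x 1 (fun y => - ln (1 - y) - mercator_sum n y) (x ^+ n / (1 - x)).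
Proof.
move=> x1; have x10 : 0 < 1 - x by rewrite subr_gt0.
have dln : is_derive x 1 (fun y : R => ln (1 - y)) (- (1 - x)^-1).
  have h : is_derive (1 - x) 1 (@ln R) (1 - x)^-1 by exact: is_derive1_ln.
  have k : is_derive x (1:R) (fun y : R => 1 - y) (-1).
    by rewrite -[X in is_derive _ _ _ X]sub0r; apply: is_deriveB.
  by have := @is_derive1_comp _ (@ln R) (fun y => 1 - y) x _ _ h k; rewrite mulrN1.
have dsum : is_derive x 1 (mercator_sum n) (\sum_(k < n) x ^+ k).
  have d k : is_derive x 1 (fun y : R => y ^+ k.+1 / k.+1%:R) (x ^+ k).
    have -> : (fun y : R => y ^+ k.+1 / k.+1%:R) =
        k.+1%:R^-1 \*: ((id : R -> R) ^+ k.+1).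
      by apply/funext => y /=; rewrite mulrC exprfctE.
    have dX : is_derive x (1:R) ((id : R -> R) ^+ k.+1) (k.+1%:R * x ^+ k).
      have := @is_deriveX R R^o id k.+1 x 1 1 (is_derive_id x 1).
      by rewrite /GRing.scale/= mulr1.
    have := @is_deriveZ R R^o R^o _ k.+1%:R^-1 x 1 _ dX.
    by rewrite /GRing.scale/= mulrA mulVf// mul1r.
  have -> : mercator_sum n = \sum_(k < n) (fun y : R => y ^+ k.+1 / k.+1%:R).
    by apply/funext => y; rewrite fct_sumE.
  exact: is_derive_sum.
have -> : x ^+ n / (1 - x) = - - (1 - x)^-1 - \sum_(k < n) x ^+ k.
  have := subrX1 x n => /(congr1 (fun z => z / (x - 1))).
  have x1' : x - 1 != 0 by rewrite lt_eqF// subr_lt0.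
  rewrite [RHS]mulrC mulKf// => <-.
  rewrite opprK; field; rewrite x1' lt0r_neq0//.
by apply: is_deriveB; apply: is_deriveN.
Qed.

Lemma mercator_rem_bound n (u : R) : 0 <= u < 1 ->
  0 <= - ln (1 - u) - mercator_sum n u <= u ^+ n / (1 - u).
Proof.
move=> /andP[u0 u1].
pose f (y : R) := - ln (1 - y) - mercator_sum n y.
pose df (y : R) := y ^+ n / (1 - y).
have d (x : R) : x \in `[0, u] -> is_derive x 1 f (df x).
  rewrite in_itv/= => /andP[_ xu].
  by apply: is_derive_mercator_rem; exact: le_lt_trans u1.
have f0 : f 0 = 0.
  rewrite /f subr0 ln1 oppr0 sub0r /mercator_sum big1 ?oppr0// => i _.
  by rewrite expr0n mul0r.
rewrite -/(f u).
have cf : {within `[0, u], continuous f}.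
  by apply: derivable_within_continuous => x /d h; exact: ex_derive.
have df' (x : R) : x \in `]0, u[ -> is_derive x 1 f (df x).
  by move=> /subset_itv_oo_cc; exact: d.
move: f f0 cf df' {d} => f f0 cf df'.
have [c] := MVT_segment u0 df' cf.
rewrite in_itv/= => /andP[c0 cu].
rewrite f0 !subr0 => ->; rewrite /df.
have c1 : 0 < 1 - c by rewrite subr_gt0 (le_lt_trans cu).
have u1' : 0 < 1 - u by rewrite subr_gt0.
have e0 : 0 <= c ^+ n / (1 - c) by rewrite divr_ge0// ?exprn_ge0// ltW.
rewrite mulr_ge0//=.
apply: (@le_trans _ _ (c ^+ n / (1 - c))); first by rewrite ler_piMr// ltW.
apply: ler_pM.
- exact: exprn_ge0.
- by rewrite invr_ge0 ltW.
- by apply: lerXn2r; rewrite // nnegrE.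
- by rewrite lef_pV2 ?posrE// lerB.
Qed.

(** At [u = 1] both sides are infinite, the left one by divergence of the
    harmonic series. *)
Lemma mercator_series (u : R) : 0 <= u <= 1 ->
  (\sum_(n <oo) (u ^+ n.+1 / n.+1%:R)%:E = - lne (1 - u)%:E)%E.
Proof.
move=> /andP[u0]; rewrite le_eqVlt => /predU1P[->|u1].
  rewrite subrr le0_lneNy//=; apply: contrapT => Soo.
  apply: (@dvg_harmonic R).
  set S := (\sum_(n <oo) _)%E in Soo.
  have f0 n : (0 <= ((1 : R) ^+ n.+1 / n.+1%:R)%:E)%E by rewrite lee_fin expr1n.
  have S0 : (0 <= S)%E by apply: nneseries_ge0.
  have Sfin : S \is a fin_num by rewrite ge0_fin_numE// ltey; apply/eqP.
  apply: nondecreasing_is_cvgn.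
    by apply: nondecreasing_series => n _ _; exact: harmonic_ge0.
  exists (fine S) => _ [n _ <-].
  rewrite -lee_fin fineK// /series/= -sumEFin.
  apply: le_trans (nneseries_lim_ge n _) => //.
  by apply: lee_sum => i _; rewrite expr1n mul1r.
have u1' : 0 < 1 - u by rewrite subr_gt0.
rewrite lne_EFin// -EFinN.
apply/cvg_lim => //.
rewrite (_ : (fun n => _) = EFin \o (fun n => mercator_sum n u)); last first.
  by apply/funext => n /=; rewrite sumEFin big_mkord.
apply: cvg_EFin; first by near=> n.
have r0 : (fun n => u ^+ n / (1 - u)) @ \oo --> (0 : R).
  rewrite -(mul0r (1 - u)^-1); apply: cvgM; last exact: cvg_cst.
  by apply: cvg_expr; rewrite ger0_norm.
have : (fun n => - ln (1 - u) - mercator_sum n u) @ \oo --> (0 : R).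
  apply: squeeze_cvgr (cvg_cst 0) r0.
  by near=> n; apply: mercator_rem_bound; rewrite u0.
move=> /(cvgB (cvg_cst (- ln (1 - u)))); rewrite subr0.
by apply: cvg_trans; apply: near_eq_cvg; near=> n; rewrite /= opprB addrCA subrr addr0.
Unshelve. all: by end_near. Qed.

End mercator.

(** * Positive definite kernels and energies *)

Section positive_kernels.
Context d (T : measurableType d) (R : realType).
Local Notation fmeas := {finite_measure set T -> \bar R}.
Implicit Types (k : T -> T -> R) (K : T -> T -> \bar R).
Implicit Types (mu nu : fmeas).

Definition mutual_energy K mu nu : \bar R := (\int[mu]_x \int[nu]_y K x y)%E.

(** Positive definite kernels of finite rank. The bound [1] on the factors makes
    them integrable and is stable under products. *)
Definition gram_kernel k := exists (I : finType) (g : I -> T -> R),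
  [/\ forall i, measurable_fun setT (g i), forall i x, `|g i x| <= 1 &
      forall x y, k x y = \sum_i g i x * g i y].

Lemma gram_kernel1 : gram_kernel (fun _ _ => 1).
Proof.
exists unit, (fun _ _ => 1); split=> [i|i x|x y].
- exact: measurable_cst.
- by rewrite normr1.
- by rewrite (big_pred1 tt) ?mulr1//; case.
Qed.

Lemma gram_kernelM k l :
  gram_kernel k -> gram_kernel l -> gram_kernel (fun x y => k x y * l x y).
Proof.
move=> [I [g [mg g1 kE]]] [J [h [mh h1 lE]]].
exists (I * J)%type, (fun p x => g p.1 x * h p.2 x); split=> [p|p x|x y].
- exact: measurable_funM.
- by rewrite normrM mulr_ile1.
- rewrite kE lE big_distrlr pair_big /=.
  by apply: eq_bigr => p _; rewrite mulrACA.
Qed.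

Lemma gram_kernelX k n : gram_kernel k -> gram_kernel (fun x y => k x y ^+ n).
Proof.
move=> gk; elim: n => [|n ih]; first exact: gram_kernel1.
have -> : (fun x y => k x y ^+ n.+1) = (fun x y => k x y * k x y ^+ n).
  by apply/funext => x; apply/funext => y; rewrite exprS.
exact: gram_kernelM.
Qed.

Lemma gram_kernel_measurable k : gram_kernel k ->
  measurable_fun setT (fun p : T * T => k p.1 p.2).
Proof.
move=> [I [g [mg _ kE]]].
have -> : (fun p : T * T => k p.1 p.2) = (fun p => \sum_i g i p.1 * g i p.2).
  by apply/funext => p; rewrite kE.
by apply: measurable_sum => i; apply: measurable_funM;
  apply: measurableT_comp.
Qed.

Section mutual_energy_gram.
Local Open Scope ereal_scope.

Lemma bounded1_integrable mu (g : T -> R) : measurable_fun setT g ->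
  (forall x, `|g x| <= 1)%R -> mu.-integrable setT (EFin \o g).
Proof.
move=> mg g1; apply: measurable_bounded_integrable => //.
  by rewrite ltey_eq fin_num_measure.
by exists 1%R; split => // M /ltW M1 x _; exact: le_trans (g1 x) M1.
Qed.

(** The energy is [sum_i a_i b_i], with [a_i] and [b_i] the integrals of the
    factors, so the inequality is [2 a b <= a^2 + b^2] for each [i]. *)
Lemma mutual_energy_gram_le k mu nu : gram_kernel k ->
  mutual_energy (fun x y => (k x y)%:E) nu mu +
    mutual_energy (fun x y => (k x y)%:E) nu mu <=
  mutual_energy (fun x y => (k x y)%:E) mu mu +
    mutual_energy (fun x y => (k x y)%:E) nu nu.
Proof.
move=> [I [g [mg g1 kE]]]; set E := mutual_energy _.
have ig i (m : fmeas) :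
    m.-integrable setT (EFin \o g i) by exact: bounded1_integrable.
pose a (m : fmeas) i :=
  fine (\int[m]_x (g i x)%:E).
have aE (m : fmeas) i : \int[m]_x (g i x)%:E = (a m i)%:E.
  by rewrite /a fineK//; exact: integrable_fin_num (ig i m).
have EE (m n : fmeas) : E m n = (\sum_i a m i * a n i)%R%:E.
  rewrite /E /mutual_energy.
  transitivity (\int[m]_x (\sum_i (a n i)%:E * (g i x)%:E)).
    apply: eq_integral => x _.
    transitivity (\int[n]_y (\sum_i (g i x)%:E * (g i y)%:E)).
      by apply: eq_integral => y _; rewrite kE -sumEFin.
    rewrite integral_sum//; last by move=> i; apply: integrableZl => //; exact: ig.
    apply: eq_bigr => i _; rewrite integralZl//; last exact: ig.
    by rewrite aE muleC.
  rewrite integral_sum//; last by move=> i; apply: integrableZl => //; exact: ig.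
  rewrite -sumEFin; apply: eq_bigr => i _; rewrite integralZl//; last exact: ig.
  by rewrite aE -EFinM mulrC.
rewrite !EE -!EFinD lee_fin -!big_split/=; apply: ler_sum => i _.
by rewrite -subr_ge0 (_ : _ - _ = (a mu i - a nu i) ^+ 2)%R ?sqr_ge0//; ring.
Qed.

(** A series of nonnegative kernels may be integrated termwise, even where it
    diverges; thus the inequality passes from the powers of a kernel to its
    logarithm. *)
Lemma mutual_energy_series_le (k : nat -> T -> T -> R) K (c : R) mu nu :
  (forall n, gram_kernel (k n)) -> (forall n x y, 0 <= k n x y)%R ->
  (0 <= c)%R ->
  (forall x y, K x y = \sum_(n <oo) (c / n.+1%:R * k n x y)%:E) ->
  mutual_energy K nu mu + mutual_energy K nu mu <=
  mutual_energy K mu mu + mutual_energy K nu nu.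
Proof.
move=> gk k0 c0 KE; set E := mutual_energy _.
have mk n := gram_kernel_measurable (gk n).
pose e n (m m' : fmeas) := mutual_energy (fun x y => (k n x y)%:E) m m'.
have e0 n (m m' : fmeas) : 0 <= e n m m'.
  by apply: integral_ge0 => x _; apply: integral_ge0 => y _; rewrite lee_fin.
have cn0 n : (0 <= c / n.+1%:R)%R by rewrite divr_ge0.
have mkx n x : measurable_fun setT (fun y => (k n x y)%:E).
  apply/measurable_EFinP.
  exact: (measurableT_comp (mk n) (measurable_pair1 x)).
have mint n (m : fmeas) :
    measurable_fun setT (fun x => \int[m]_y (k n x y)%:E).
  apply: (@measurable_fun_fubini_tonelli_F _ _ _ _ _ m
    (fun p => (k n p.1 p.2)%:E)).
  - exact/measurable_EFinP.
  - by move=> p; rewrite lee_fin.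
have EE (m m' : fmeas) : E m m' = \sum_(n <oo) (c / n.+1%:R)%:E * e n m m'.
  rewrite /E /mutual_energy.
  transitivity (\int[m]_x \sum_(n <oo)
      ((c / n.+1%:R)%:E * \int[m']_y (k n x y)%:E)).
    apply: eq_integral => x _.
    under eq_integral do rewrite KE.
    rewrite integral_nneseries//.
    - apply: eq_eseriesr => n _.
      under eq_integral do rewrite EFinM.
      by rewrite ge0_integralZl_EFin// => y _; rewrite lee_fin.
    - by move=> n; under eq_fun do rewrite EFinM; exact: measurable_funeM.
    - by move=> n y _; rewrite lee_fin mulr_ge0.
  rewrite integral_nneseries//.
  - apply: eq_eseriesr => n _; rewrite ge0_integralZl_EFin//.
    by move=> x _; apply: integral_ge0 => y _; rewrite lee_fin.
  - by move=> n; exact: measurable_funeM.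
  - move=> n x _; rewrite mule_ge0 ?lee_fin//.
    by apply: integral_ge0 => y _; rewrite lee_fin.
have ce0 n (m m' : fmeas) : 0 <= (c / n.+1%:R)%:E * e n m m'.
  by rewrite mule_ge0 ?lee_fin.
rewrite !EE -!nneseriesD//; apply: lee_nneseries => n _.
  by rewrite adde_ge0.
rewrite -!ge0_muleDr// lee_wpmul2l ?lee_fin//.
exact: mutual_energy_gram_le.
Qed.

End mutual_energy_gram.

End positive_kernels.

(** * The chordal kernel *)

Section spherical_kernel.
Context {R : realType}.
Implicit Types (x y z : Cplx R).

Lemma measurable_continuous (f : Cplx R -> R) :
  continuous f -> measurable_fun [set: borelC R] (f : borelC R -> R).
Proof.
move=> cf; apply: (measurability _ (RGenOpens.measurableE R)).
move=> _ [_ [a [b ->]] <-]; rewrite setTI; apply: open_borel.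
by move/continuousP : cf; apply; exact: interval_open.
Qed.

Lemma measurable_re : measurable_fun [set: borelC R] (re : borelC R -> R).
Proof. exact: measurable_continuous continuous_re. Qed.

Lemma measurable_im : measurable_fun [set: borelC R] (im : borelC R -> R).
Proof. exact: measurable_continuous continuous_im. Qed.

(** The square of the factor by which stereographic projection shrinks
    distances is, up to a constant, the inverse of the product of these
    quantities at the two points. *)
Definition sph z : R := 1 + cabs z ^+ 2.

Definition log_sph z : R := ln (sph z) / 2.

Lemma sph_ge1 z : 1 <= sph z.
Proof. by rewrite lerDl sqr_ge0. Qed.

Lemma sph_gt0 z : 0 < sph z.
Proof. exact: lt_le_trans (sph_ge1 z). Qed.

Lemma log_sph_ge0 z : 0 <= log_sph z.
Proof. by rewrite divr_ge0// ln_ge0// sph_ge1. Qed.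

(** The number [(1 + cos a) / 2], where [a] is the angle between the
    stereographic projections of [x] and [y]. *)
Definition chordal_overlap x y : R :=
  1 - cabs (x - y) ^+ 2 / (sph x * sph y).

(** Minus the logarithm of the normalized chordal distance. *)
Definition spherical_kernel x y : \bar R :=
  (- log_dist x y + (log_sph x + log_sph y)%:E)%E.

Lemma sphE z : sph z = 1 + re z ^+ 2 + im z ^+ 2.
Proof. by rewrite /sph sqr_cabs addrA. Qed.

Lemma continuous_sph : continuous sph.
Proof.
move=> z; rewrite (_ : sph = (fun z => 1 + re z * re z + im z * im z)); last first.
  by apply/funext => w; rewrite sphE !expr2.
have cr := @continuous_re R z; have ci := @continuous_im R z.
exact: (cvgD (cvgD (cvg_cst (1 : R)) (cvgM cr cr)) (cvgM ci ci)).
Qed.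

Lemma measurable_sph_inv :
  measurable_fun [set: borelC R] (fun z : borelC R => (sph z)^-1).
Proof.
apply: measurable_continuous => z.
exact: (cvgV (lt0r_neq0 (sph_gt0 z)) (@continuous_sph z)).
Qed.

Let overlap_feature (i : 'I_6) z : R :=
  nth 0 [:: 1; re z; re z; im z; im z; re z ^+ 2 + im z ^+ 2] i / sph z.

(** Expanding [(1 + |x|^2) (1 + |y|^2) - |x - y|^2] leaves
    [1 + 2 (re x) (re y) + 2 (im x) (im y) + |x|^2 |y|^2]; the coefficients [2]
    are accounted for by repeating a feature. *)
Lemma chordal_overlap_gram : gram_kernel (chordal_overlap : borelC R -> borelC R -> R).
Proof.
exists 'I_6, overlap_feature; split => [i|i z|x y].
- apply: measurable_funM; last exact: measurable_sph_inv.
  case: i => -[|[|[|[|[|[|//]]]]]] ? /=.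
  + exact: measurable_cst.
  + exact: measurable_re.
  + exact: measurable_re.
  + exact: measurable_im.
  + exact: measurable_im.
  + by apply: measurable_funD; apply: measurable_funX; [exact: measurable_re|exact: measurable_im].
- rewrite normrM normfV (gtr0_norm (sph_gt0 z)) ler_pdivrMr ?sph_gt0// mul1r sphE ler_norml.
  by case: i => -[|[|[|[|[|[|//]]]]]] ? /=; apply/andP; split; nra.
- rewrite !big_ord_recl big_ord0 /overlap_feature /=.
  rewrite /chordal_overlap sqr_cabs reB imB.
  have := lt0r_neq0 (sph_gt0 x); have := lt0r_neq0 (sph_gt0 y); rewrite !sphE => hy hx.
  by field; rewrite hx hy.
Qed.

(** Nonnegativity is Lagrange's identity
    [(1 + |x|^2) (1 + |y|^2) = |1 + x y^*|^2 + |x - y|^2]. *)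
Lemma chordal_overlap_itv x y : 0 <= chordal_overlap x y <= 1.
Proof.
rewrite /chordal_overlap; apply/andP; split; last first.
  by rewrite lerBlDr lerDl divr_ge0 ?sqr_ge0// mulr_ge0 ?ltW ?sph_gt0.
rewrite subr_ge0 ler_pdivrMr ?mulr_gt0 ?sph_gt0// mul1r.
rewrite -subr_ge0 sqr_cabs reB imB !sphE.
rewrite (_ : _ - _ = (1 + re x * re y + im x * im y) ^+ 2 +
                     (re y * im x - re x * im y) ^+ 2); last by ring.
by rewrite addr_ge0 ?sqr_ge0.
Qed.

Lemma spherical_kernelE x y : spherical_kernel x y =
  ((2^-1)%:E * - lne (1 - chordal_overlap x y)%:E)%E.
Proof.
rewrite /spherical_kernel /chordal_overlap subKr /log_dist.
have [xy|xy] := eqVneq (cabs (x - y)) 0.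
  rewrite xy expr0n mul0r !le0_lneNy// /=.
  by rewrite gt0_muley// lte_fin invr_gt0.
have xy0 : 0 < cabs (x - y) by rewrite lt_neqAle eq_sym xy cabs_ge0.
rewrite !lne_EFin ?divr_gt0 ?exprn_gt0 ?mulr_gt0 ?sph_gt0//.
rewrite -!EFinN -EFinD -EFinM; congr EFin.
rewrite ln_div ?posrE ?exprn_gt0 ?mulr_gt0 ?sph_gt0// lnM ?posrE ?sph_gt0// lnXn//.
by rewrite /log_sph; field.
Qed.

Lemma spherical_kernel_series x y : spherical_kernel x y =
  (\sum_(n <oo) (2^-1 / n.+1%:R * chordal_overlap x y ^+ n.+1)%:E)%E.
Proof.
rewrite spherical_kernelE -mercator_series ?chordal_overlap_itv//.
have /andP[u0 _] := chordal_overlap_itv x y.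
rewrite -nneseriesZl; last by move=> n _; rewrite lee_fin divr_ge0 ?exprn_ge0.
by apply: eq_eseriesr => n _; rewrite -EFinM; congr EFin; rewrite mulrA mulrAC.
Qed.

Lemma spherical_kernel_ge0 x y : (0 <= spherical_kernel x y)%E.
Proof.
rewrite spherical_kernel_series; apply: nneseries_ge0 => n _ _.
have /andP[u0 _] := chordal_overlap_itv x y.
by rewrite lee_fin mulr_ge0 ?exprn_ge0// divr_ge0.
Qed.

Definition spherical_energy (mu nu : fmeasC R) : \bar R :=
  @mutual_energy _ (borelC R) R spherical_kernel mu nu.

(** The positive definiteness of the spherical kernel. Unlike for the planar
    logarithmic kernel, the masses of [mu] and [nu] need not agree. *)
Lemma spherical_energy_le (mu nu : fmeasC R) :
  (spherical_energy nu mu + spherical_energy nu mu <=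
   spherical_energy mu mu + spherical_energy nu nu)%E.
Proof.
apply: (@mutual_energy_series_le _ (borelC R) R
  (fun n x y => chordal_overlap x y ^+ n.+1) _ 2^-1) => //.
- by move=> n; apply: gram_kernelX; exact: chordal_overlap_gram.
- by move=> n x y; rewrite exprn_ge0//; have /andP[] := chordal_overlap_itv x y.
- exact: spherical_kernel_series.
Qed.

Lemma measurable_log_sph :
  measurable_fun [set: borelC R] (log_sph : borelC R -> R).
Proof.
apply: measurable_funM; last exact: measurable_cst.
apply: measurableT_comp; first exact: measurable_ln.
exact: measurable_continuous continuous_sph.
Qed.

Lemma measurable_lne_EFin : measurable_fun [set: R] (fun r : R => lne r%:E).
Proof.
apply: measurable_fun_ifT.
- by apply: measurable_fun_ler => //; exact: measurable_cst.
- exact: measurable_cst.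
- by apply/measurable_EFinP; exact: measurable_ln.
Qed.

Lemma measurable_log_dist : measurable_fun [set: borelC R * borelC R]
  (fun p : borelC R * borelC R => log_dist p.1 p.2).
Proof.
apply: (measurableT_comp measurable_lne_EFin
  (g := fun p : borelC R * borelC R => cabs (p.1 - p.2 : Cplx R))).
have -> : (fun p : borelC R * borelC R => cabs (p.1 - p.2 : Cplx R)) =
    (fun p => Num.sqrt ((re p.1 - re p.2) ^+ 2 + (im p.1 - im p.2) ^+ 2)).
  by apply/funext => p; rewrite cabsE reB imB.
apply: measurableT_comp.
  by apply: continuous_measurable_fun; exact: sqrt_continuous.
by apply: measurable_funD; apply: measurable_funX; apply: measurable_funB;
  apply: measurableT_comp => //;
  (exact: measurable_re || exact: measurable_im).
Qed.

Lemma measurable_spherical_kernel : measurable_fun [set: borelC R * borelC R]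
  (fun p : borelC R * borelC R => spherical_kernel p.1 p.2).
Proof.
apply: emeasurable_funD.
  by apply: measurableT_comp => //; exact: measurable_log_dist.
apply/measurable_EFinP; apply: measurable_funD;
  by apply: measurableT_comp => //; exact: measurable_log_sph.
Qed.

End spherical_kernel.

(** * Two complements on integrals *)

Section integral_complements.
Local Open Scope ereal_scope.
Context d (T : measurableType d) (R : realType).

(** The integral of [g] may be infinite: subtracting an integrable function
    then leaves it infinite, because the negative part stays integrable. *)
Lemma ge0_integralB_integrable (mu : {measure set T -> \bar R}) (D : set T)
    (g : T -> \bar R) (h : T -> R) :
  measurable D -> measurable_fun D g -> (forall x, D x -> 0 <= g x) ->
  mu.-integrable D (EFin \o h) ->
  \int[mu]_(x in D) (g x - (h x)%:E) =
    \int[mu]_(x in D) g x - \int[mu]_(x in D) (h x)%:E /\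
  \int[mu]_(x in D) ((h x)%:E - g x) =
    \int[mu]_(x in D) (h x)%:E - \int[mu]_(x in D) g x.
Proof.
move=> mD mg g0 ih.
have mh := measurable_int mu ih.
have [/eqP|] := eqVneq (\int[mu]_(x in D) g x) +oo; last first.
  rewrite -ltey => goo.
  have ig : mu.-integrable D g.
    apply/integrableP; split => //.
    rewrite (_ : \int[mu]_(x in D) _ = \int[mu]_(x in D) g x)//.
    by apply: eq_integral => x; rewrite inE => Dx; rewrite gee0_abs// g0.
  by split; exact: (integralB mD).
move=> /eqP goo.
pose f x := g x - (h x)%:E.
have mf : measurable_fun D f by exact: emeasurable_funB.
have mfp := measurable_funepos mf; have mfn := measurable_funeneg mf.
have ihfin := integrable_fin_num mD ih.
have [_ ihabs] := integrableP _ _ _ ih.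
have fnoo : \int[mu]_(x in D) f^\- x < +oo.
  apply: le_lt_trans ihabs; apply: ge0_le_integral => //.
    by apply: measurableT_comp.
  move=> x Dx; rewrite funenegE /f.
  rewrite ge_max abse_ge0 andbT oppeB ?fin_num_adde_defl// addeC.
  rewrite (le_trans _ (lee_abs _))// geeDl// oppe_le0; exact: g0.
have fpoo : \int[mu]_(x in D) f^\+ x = +oo.
  apply/eqP; rewrite -leye_eq -(@leeD2rE _ (\int[mu]_(x in D) `|(h x)%:E|)); last first.
    by rewrite ge0_fin_numE//; apply: integral_ge0.
  rewrite -ge0_integralD//; last exact: measurableT_comp.
  rewrite addye ?gt_eqF//; last by rewrite (lt_le_trans (ltNyr 0))// integral_ge0.
  rewrite -goo; apply: ge0_le_integral => //.
    by apply: emeasurable_funD => //; exact: measurableT_comp.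
  move=> x Dx; rewrite funeposE /f.
  apply: (@le_trans _ _ (g x - (h x)%:E + `|(h x)%:E|)); last first.
    by rewrite leeD2r// le_max lexx.
  by rewrite -addeA leeDl// addeC sube_ge0 ?lee_abs.
have nfn : (- \int[mu]_(x in D) f^\- x) \is a fin_num.
  by rewrite fin_numN ge0_fin_numE//; apply: integral_ge0.
have nh : (- \int[mu]_(x in D) (h x)%:E) \is a fin_num by rewrite fin_numN.
have fE : \int[mu]_(x in D) f x = +oo.
  by rewrite integralE fpoo addye//; move: nfn; rewrite fin_numE => /andP[].
rewrite goo; split.
  by rewrite fE addye//; move: nh; rewrite fin_numE => /andP[].
rewrite addeNy.
transitivity (\int[mu]_(x in D) - f x).
  by apply: eq_integral => x _; rewrite /f oppeB ?fin_num_adde_defl// addeC.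
by rewrite integralN ?fE// fin_num_adde_defl.
Qed.

(** [mu] is the sum of its restrictions to [A] and to the complement of [A]. *)
Lemma ge0_integral_mrestr_le (mu : {measure set T -> \bar R}) (A : set T)
    (mA : measurable A) (f : T -> \bar R) :
  measurable_fun setT f -> (forall x, 0 <= f x) ->
  \int[mrestr mu mA]_x f x <= \int[mu]_x f x.
Proof.
move=> mf f0.
rewrite (@eq_measure_integral _ _ _ setT
  (measure_add (mrestr mu mA) (mrestr mu (measurableC mA))) mu); last first.
  move=> B mB _; rewrite [RHS]measure_addE.
  rewrite -[X in mu X = _](setIT B) -(setUv A) setIUr measureU//.
  - exact: measurableI.
  - by apply: measurableI => //; exact: measurableC.
  - by rewrite setIACA setICr setI0.
by rewrite ge0_integral_measure_add// leeDl// integral_ge0.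
Qed.

End integral_complements.

(** * Spherical potentials and polar sets *)

Section potentials.
Local Open Scope ereal_scope.
Context {R : realType}.
Implicit Types (mu nu sigma : fmeasC R).

Definition spherical_potential mu (x : Cplx R) : \bar R :=
  \int[mu]_y spherical_kernel x y.

Lemma measurable_spherical_kernelr (x : Cplx R) :
  measurable_fun [set: borelC R] (spherical_kernel x : borelC R -> \bar R).
Proof.
exact: (measurableT_comp measurable_spherical_kernel
  (@measurable_pair1 _ _ (borelC R) (borelC R) x)).
Qed.

Lemma measurable_spherical_potential mu :
  measurable_fun [set: borelC R] (spherical_potential mu : borelC R -> \bar R).
Proof.
apply: (@measurable_fun_fubini_tonelli_F _ _ (borelC R) (borelC R) R mu
  (fun p => spherical_kernel p.1 p.2)).
- exact: measurable_spherical_kernel.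
- by move=> p; exact: spherical_kernel_ge0.
Qed.

Lemma spherical_potential_ge0 mu (x : Cplx R) : 0 <= spherical_potential mu x.
Proof. by apply: integral_ge0 => y _; exact: spherical_kernel_ge0. Qed.

Lemma spherical_energyE sigma mu :
  spherical_energy sigma mu = \int[sigma]_x spherical_potential mu x.
Proof. by []. Qed.

Lemma spherical_energy_prod sigma mu : spherical_energy sigma mu =
  \int[sigma \x mu]_p spherical_kernel p.1 p.2.
Proof.
rewrite (@fubini_tonelli1 _ _ (borelC R) (borelC R))//.
- exact: measurable_spherical_kernel.
- by move=> p; exact: spherical_kernel_ge0.
Qed.

Lemma spherical_energy_ge0 sigma mu : 0 <= spherical_energy sigma mu.
Proof. by apply: integral_ge0 => x _; exact: spherical_potential_ge0. Qed.

Lemma spherical_energy_restr_le sigma (A : set (borelC R)) (mA : measurable A)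
    (c : {nonneg R}) (nu : fmeasC R) : nu = mscale c (mrestr sigma mA) ->
  spherical_energy nu nu <= (c%:num * c%:num)%:E * spherical_energy sigma sigma.
Proof.
move=> nuE; have c0 : (0 <= c%:num)%R by [].
have le_nu (f : borelC R -> \bar R) : measurable_fun setT f ->
    (forall x, 0 <= f x) -> \int[nu]_x f x <= c%:num%:E * \int[sigma]_x f x.
  move=> mf f0; rewrite nuE ge0_integral_mscale// lee_wpmul2l//.
  exact: ge0_integral_mrestr_le.
have mU := measurable_spherical_potential.
rewrite !spherical_energyE.
apply: le_trans (le_nu _ (mU _) (spherical_potential_ge0 _)) _.
rewrite EFinM -muleA lee_wpmul2l// -ge0_integralZl_EFin//; last first.
  by move=> x _; exact: spherical_potential_ge0.
apply: ge0_le_integral => //.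
- by move=> x _; exact: spherical_potential_ge0.
- exact: measurable_funeM.
- move=> x _; apply: le_nu; first exact: measurable_spherical_kernelr.
  by move=> y; exact: spherical_kernel_ge0.
Qed.

(** The spherical kernel dominates the positive part of [- log |x - y|]. *)
Lemma log_energy_ltoo nu : spherical_energy nu nu < +oo -> log_energy nu < +oo.
Proof.
rewrite spherical_energy_prod => Eoo.
pose f (p : borelC R * borelC R) := log_dist p.1 p.2.
have mf : measurable_fun setT f by exact: measurable_log_dist.
have foo : \int[nu \x nu]_p f^\- p < +oo.
  apply: le_lt_trans Eoo; apply: ge0_le_integral => //.
  - exact: measurable_funeneg.
  - exact: measurable_spherical_kernel.
  - move=> p _; rewrite funenegE ge_max spherical_kernel_ge0 andbT.
    by rewrite leeDl// lee_fin addr_ge0// log_sph_ge0.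
have f0 : 0 <= \int[nu \x nu]_p f^\- p by exact: integral_ge0.
have p0 : 0 <= \int[nu \x nu]_p f^\+ p by exact: integral_ge0.
rewrite /log_energy -/f integralE oppeB; last first.
  by rewrite fin_num_adde_defl// fin_numN ge0_fin_numE.
by rewrite lte_add_pinfty// lteNl (lt_le_trans _ p0)// ltNyr.
Qed.

(** Otherwise [A] contains a compact set of positive measure; the normalized
    restriction of [sigma] to it has logarithmic energy less than [+oo], which
    contradicts the vanishing of the capacity of [N]. *)
Lemma polar_null sigma (N : set (Cplx R)) (A : set (borelC R)) :
  spherical_energy sigma sigma < +oo -> log_capacity N = 0 ->
  measurable A -> A `<=` N -> sigma A = 0.
Proof.
move=> Efin capN mA AN; apply: inner_compact_null => // K cK KA.
apply/eqP; apply/negPn/negP => K0.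
have mK := compact_borel cK.
have sKfin : sigma K \is a fin_num by exact: fin_num_measure.
have fK0 : (0 < fine (sigma K))%R.
  by rewrite fine_gt0// lt0e K0 measure_ge0/= -ge0_fin_numE.
have cK0 : (0 <= (fine (sigma K))^-1)%R by rewrite invr_ge0 ltW.
pose nu : fmeasC R := mscale (NngNum cK0) (mrestr sigma mK).
have nuE (B : set (borelC R)) :
  nu B = (fine (sigma K))^-1%:E * sigma (B `&` K) by [].
have nu1 : nu setT = 1.
  by rewrite nuE setTI -[X in _ * X]fineK// -EFinM mulVf// lt0r_neq0.
have suppK : measure_support nu `<=` K.
  move=> z /(_ (~` K)) nuz; apply: contrapT => Kz.
  have : 0 < nu (~` K).
    apply: nuz; split => //; rewrite openC.
    exact: compact_closed hausdorff_Cplx cK.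
  by rewrite nuE setICl measure0 mule0 ltxx.
have csupp : compact (measure_support nu).
  by apply: (subclosed_compact _ cK suppK); exact: closed_support.
have nuN : measure_support nu `<=` N.
  by apply: subset_trans suppK _; exact: subset_trans KA AN.
have nufin : spherical_energy nu nu < +oo.
  apply: le_lt_trans (@spherical_energy_restr_le sigma K mK (NngNum cK0) nu erefl) _.
  by rewrite lte_mul_pinfty// lee_fin mulr_ge0.
have := log_energy_ltoo nufin; apply/negP; rewrite -leNgt.
have -> : +oo = ereal_inf [set log_energy sigma | sigma in
    [set sigma : fmeasC R | [/\ sigma setT = 1,
       compact (measure_support sigma) & measure_support sigma `<=` N]]].
  move: capN; rewrite /log_capacity; case: ereal_inf => [r| |]//=.
  by move=> [/eqP]; rewrite gt_eqF// expR_gt0.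
by apply: ereal_inf_lbound; exists nu.
Qed.

End potentials.

(** * Measures of finite logarithmic energy *)

Section finite_log_energy.
Local Open Scope ereal_scope.
Context {R : realType}.
Implicit Types (mu nu sigma : fmeasC R) (x y z : Cplx R).

Lemma log_sph_sub_le x y : (log_sph y <= ln 2 / 2 + log_sph x + log_sph (x - y))%R.
Proof.
rewrite /log_sph -!mulrDl ler_wpM2r// -!lnM ?posrE ?mulr_gt0 ?sph_gt0//.
rewrite ler_ln ?posrE ?mulr_gt0 ?sph_gt0// !sphE reB imB.
set a := re x; set b := im x; set c := re y; set d := im y.
have h1 : (c ^+ 2 <= 2 * (a ^+ 2 + (a - c) ^+ 2))%R.
  by rewrite -subr_ge0 (_ : _ - _ = (2 * a - c) ^+ 2)%R ?sqr_ge0//; ring.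
have h2 : (d ^+ 2 <= 2 * (b ^+ 2 + (b - d) ^+ 2))%R.
  by rewrite -subr_ge0 (_ : _ - _ = (2 * b - d) ^+ 2)%R ?sqr_ge0//; ring.
have h3 : (0 <= (a ^+ 2 + b ^+ 2) * ((a - c) ^+ 2 + (b - d) ^+ 2))%R.
  by rewrite mulr_ge0// addr_ge0 ?sqr_ge0.
have h4 := sqr_ge0 a; have h5 := sqr_ge0 b.
by nra.
Qed.

Lemma log_sph_le_abs z :
  (log_sph z)%:E <= (ln 2 / 2)%:E + `|lne (cabs z)%:E|.
Proof.
have [z0|z0] := leP (cabs z) 0%R; first by rewrite le0_lneNy// addey ?leey.
rewrite lne_EFin//= -EFinD lee_fin /log_sph.
have sq0 : (0 < cabs z ^+ 2)%R by rewrite exprn_gt0.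
have [z1|z1] := leP 1%R (cabs z).
  have : (ln (sph z) <= ln (2 * cabs z ^+ 2))%R.
    rewrite ler_ln ?posrE ?sph_gt0 ?mulr_gt0// /sph mulr_natl mulr2n lerD2r.
    exact: exprn_ege1.
  rewrite lnM ?posrE// lnXn// (ger0_norm (ln_ge0 z1)); lra.
have : (ln (sph z) <= ln 2)%R.
  rewrite ler_ln ?posrE ?sph_gt0// /sph -natr1 addrC lerD2r expr_le1//; exact: ltW.
by have := normr_ge0 (ln (cabs z)); lra.
Qed.

(** A finite value of the integral excludes both kinds of divergence, as
    [+oo - +oo] is infinite by convention. *)
Lemma log_dist_integrable mu : log_energy mu \is a fin_num ->
  (mu \x mu).-integrable setT
    (fun p : borelC R * borelC R => log_dist p.1 p.2).
Proof.
rewrite /log_energy fin_numN => fE.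
have mf := @measurable_log_dist R.
apply/integrableP; split => //; apply/abse_integralP => //.
by rewrite -fin_num_abs.
Qed.

(** By Fubini there is a point [x] such that [log |x - y|] is integrable in
    [y], and up to a constant [|log |x - y||] dominates the growth of
    [log (1 + |y|^2)]. *)
Lemma log_sph_integrable mu : log_energy mu \is a fin_num -> 0 < mu setT ->
  mu.-integrable setT (EFin \o log_sph : borelC R -> \bar R).
Proof.
move=> /log_dist_integrable il mu0.
have mL : measurable_fun [set: borelC R] (EFin \o log_sph : borelC R -> \bar R).
  by apply/measurable_EFinP; exact: measurable_log_sph.
have [x ix] : exists x : borelC R,
    mu.-integrable setT (fun y : borelC R => log_dist x y).
  apply: contrapT => nex.
  have [N [mN N0 subN]] := ae_integrable1 il.
  suff NT : N = setT by move: mu0; rewrite -NT N0 ltxx.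
  apply/seteqP; split => // x _; apply: subN => /= ix; apply: nex.
  by exists x.
apply: (@le_integrable _ _ _ mu setT _ _
  (fun y : borelC R => (ln 2 / 2 + log_sph x + ln 2 / 2)%:E + `|log_dist x y|)) => //.
- move=> y _ /=; rewrite (ger0_norm (log_sph_ge0 y)) gee0_abs; last first.
    rewrite adde_ge0// lee_fin !addr_ge0 ?log_sph_ge0// divr_ge0// ln_ge0//; lra.
  apply: (@le_trans _ _ (ln 2 / 2 + log_sph x + log_sph (x - y))%:E).
    by rewrite lee_fin; exact: log_sph_sub_le.
  by rewrite EFinD [in leRHS]EFinD -addeA leeD2l//; exact: log_sph_le_abs.
- apply: integrableD => //; last exact: integrable_abse.
  exact: finite_measure_integrable_cst.
Qed.

Lemma integral_fst mu (f : borelC R -> \bar R) :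
  measurable_fun setT f -> (forall x, 0 <= f x) ->
  \int[mu \x mu]_p f p.1 = mu setT * \int[mu]_x f x.
Proof.
move=> mf f0; rewrite (@fubini_tonelli1 _ _ (borelC R) (borelC R))//; last first.
  exact: measurableT_comp.
rewrite -ge0_integralZl//.
by apply: eq_integral => x _; rewrite /fubini_F /= integral_cst// muleC.
Qed.

Lemma integral_snd mu (f : borelC R -> \bar R) :
  measurable_fun setT f -> (forall x, 0 <= f x) ->
  \int[mu \x mu]_p f p.2 = mu setT * \int[mu]_x f x.
Proof.
move=> mf f0; rewrite (@fubini_tonelli1 _ _ (borelC R) (borelC R))//; last first.
  exact: measurableT_comp.
by rewrite /fubini_F /= integral_cst// muleC.
Qed.

Lemma spherical_energy_ltoo mu : log_energy mu \is a fin_num -> 0 < mu setT ->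
  spherical_energy mu mu < +oo.
Proof.
move=> fE mu0; have /integrableP[_ +] := log_sph_integrable fE mu0.
rewrite spherical_energy_prod.
set J := \int[mu]_x _ => Joo.
have [mf foo] := integrableP _ _ _ (log_dist_integrable fE).
have mL : measurable_fun [set: borelC R] (fun x : borelC R => `|(log_sph x)%:E|).
  by apply: measurableT_comp => //; apply/measurable_EFinP; exact: measurable_log_sph.
have mL1 : measurable_fun [set: borelC R * borelC R]
  (fun p : borelC R * borelC R => `|(log_sph p.1)%:E|) by exact: measurableT_comp mL _.
have mL2 : measurable_fun [set: borelC R * borelC R]
  (fun p : borelC R * borelC R => `|(log_sph p.2)%:E|) by exact: measurableT_comp mL _.
apply: (@le_lt_trans _ _ (\int[mu \x mu]_p (`|log_dist p.1 p.2| +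
    (`|(log_sph p.1)%:E| + `|(log_sph p.2)%:E|)))).
  apply: ge0_le_integral => //.
  - by move=> p _; exact: spherical_kernel_ge0.
  - exact: measurable_spherical_kernel.
  - by apply: emeasurable_funD; [exact: measurableT_comp|exact: emeasurable_funD].
  - move=> p _; rewrite /spherical_kernel leeD//.
      by rewrite -abseN lee_abs.
    by rewrite EFinD leeD// lee_abs.
rewrite ge0_integralD//; last 3 first.
- exact: measurableT_comp.
- by move=> p _; rewrite adde_ge0.
- exact: emeasurable_funD.
rewrite ge0_integralD// (integral_fst mu mL)// (integral_snd mu mL)//.
have J0 : 0 <= J by exact: integral_ge0.
rewrite -/J; move: J J0 Joo => J J0 Joo.
rewrite lte_add_pinfty// -ge0_muleDr//.
have -> : mu setT = (fine (mu setT))%:E by rewrite fineK// fin_num_measure.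
by rewrite lte_mul_pinfty ?lte_add_pinfty// lee_fin fine_ge0.
Qed.

(** For measures with a finite integral of [log_sph], the spherical and the
    logarithmic potential differ by an explicit finite function. *)
Lemma spherical_potentialE mu z :
  mu.-integrable setT (EFin \o log_sph : borelC R -> \bar R) ->
  spherical_potential mu z = log_potential mu z +
    (fine (mu setT) * log_sph z + fine (\int[mu]_y (log_sph y)%:E))%:E.
Proof.
move=> iL.
have ic : mu.-integrable setT (fun=> (log_sph z)%:E).
  exact: finite_measure_integrable_cst.
have ih : mu.-integrable setT
    (EFin \o (fun y : borelC R => log_sph z + log_sph y)%R).
  exact: integrableD ic iL.
have hE : \int[mu]_y (log_sph z + log_sph y)%:E =
    (fine (mu setT) * log_sph z + fine (\int[mu]_y (log_sph y)%:E))%:E.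
  under eq_integral do rewrite EFinD.
  transitivity ((log_sph z)%:E * mu setT + \int[mu]_y (log_sph y)%:E).
    by rewrite integralD// integral_cst.
  have /fineK <- : mu setT \is a fin_num by exact: fin_num_measure.
  have /fineK <- : \int[mu]_y (log_sph y)%:E \is a fin_num.
    exact: integrable_fin_num iL.
  by rewrite -EFinM -EFinD (mulrC (log_sph z)).
have [_ +] := @ge0_integralB_integrable _ (borelC R) R mu setT
  (spherical_kernel z) (fun y : borelC R => log_sph z + log_sph y)%R measurableT
  (measurable_spherical_kernelr z)
  (fun y _ => spherical_kernel_ge0 z y) ih.
rewrite (_ : \int[mu]_y (_ - _) = \int[mu]_y log_dist z y); last first.
  apply: eq_integral => y _; rewrite /spherical_kernel.
  by rewrite fin_num_oppeD// oppeK addeCA subee// adde0.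
rewrite hE /log_potential => ->.
by rewrite oppeB ?fin_num_adde_defr// addeC addeA -EFinN -EFinD subrr add0e.
Qed.

End finite_log_energy.

(** * Weakly admissible external fields *)

Section external_field.
Local Open Scope ereal_scope.
Context {R : realType}.
Implicit Types (mu nu sigma : fmeasC R) (x y z : Cplx R).
Variables (t : R) (Sigma : set (Cplx R)) (Q : Cplx R -> \bar R).
Hypothesis cSigma : closed Sigma.

Lemma lsc_measurable : lower_semicontinuous (Q : subspace Sigma -> \bar R) ->
  measurable_fun (Sigma : set (borelC R)) (Q : borelC R -> \bar R).
Proof.
move=> /lower_semicontinuousP lQ.
apply: (measurability _ (ErealGenOInfty.measurableE R)).
move=> _ [_ [a ->] <-]; rewrite preimage_itvoy.
have /open_subspaceP[U oU UE] := lQ a.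
rewrite setIC -UE; apply: measurableI; first exact: open_borel.
exact: closed_borel.
Qed.

(** Locally [Q] is bounded below by semicontinuity; compactness makes the bound
    uniform. *)
Lemma lsc_bounded_below (K : set (Cplx R)) : compact K ->
  (forall z, Sigma z -> -oo < Q z) ->
  lower_semicontinuous (Q : subspace Sigma -> \bar R) ->
  exists m : R, forall z, K z -> Sigma z -> m%:E <= Q z.
Proof.
move=> cK QNy lQ.
have cA : compact (K `&` Sigma) by exact: compact_closedI.
have [z KSz|N _ /(_ N (leqnn _)) KQ] :=
  (compact_near_coveringP _).1 cA nat \oo
    (fun m z => Sigma z -> (- m%:R)%R%:E < Q z) _.
  have Sz := KSz.2.
  have [a aQ] : exists a : R, a%:E < Q z.
    move: (QNy z Sz); case: (Q z) => [r| |]//= _.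
      by exists (r - 1)%R; rewrite lte_fin ltrBlDr ltrDl.
    by exists 0%R; rewrite ltry.
  have [V zV VQ] := lQ z a aQ.
  have wV : within Sigma (nbhs z) V by rewrite (nbhs_subspace_in Sz).
  exists ([set y | Sigma y -> V y], [set m : nat | (- a <= m%:R)%R]).
    split => //=; exists (Num.truncn `|a|).+1 => // m /=.
    rewrite -(ler_nat R) => am; rewrite (le_trans _ am)// ltW//.
    by rewrite (le_lt_trans (ler_norm _))// normrN truncnS_gt.
  move=> [y m] [/= Vy am] Sy; apply: le_lt_trans (VQ y (Vy Sy)).
  by rewrite lee_fin lerNl.
exists (- N%:R)%R => z Kz Sz; apply/ltW.
exact: KQ.
Qed.

(** Near infinity this is the condition on the limit inferior, since [log_sph]
    is [log |z|] up to a bounded error; elsewhere it is semicontinuity. *)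
Lemma weakly_admissible_lower_bound : (0 < t)%R ->
  weakly_admissible t Sigma Q ->
  exists c : R, forall z, Sigma z -> (t * log_sph z - c)%:E <= Q z.
Proof.
move=> t0 [QNy lQ _ /=]; rewrite limf_einfE => /ereal_sup_gt[_ [V + <-]].
move=> /= [r _ rV] Vy.
have [a aQ] : exists a : R, forall z, V z -> (a + t * ln (cabs z))%:E <= Q z.
  have Va z : V z -> ereal_inf [set Q z - (t * ln (cabs z))%:E | z in V] <=
      Q z - (t * ln (cabs z))%:E.
    by move=> Vz; apply: ereal_inf_lbound; exists z.
  case: ereal_inf Vy Va => [b| |]// _ Va; [exists b|exists 0%R] => z Vz.
    by rewrite EFinD -leeBrDr//; exact: Va.
  have := Va z Vz; rewrite leye_eq => /eqP.
  by case: (Q z) => //= *; rewrite leey.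
pose n := (Num.truncn (Num.max r 1%R)).+1.
have [m mQ] := lsc_bounded_below (@square_compact R n) QNy lQ.
pose M : R := (t * (ln (1 + (n%:R ^+ 2 + n%:R ^+ 2)) / 2))%R.
exists (Num.max (M - m) (t * (ln 2 / 2) - a))%R => z Sz.
have [nz|nz] := pselect (square n z).
  apply: le_trans (mQ z nz Sz); rewrite lee_fin lerBlDr -lerBlDl.
  rewrite le_max; apply/orP; left; rewrite lerD2r ler_pM2l//.
  have n0 : (0 < 1 + (n%:R ^+ 2 + n%:R ^+ 2) :> R)%R.
    by rewrite ltr_pwDl// addr_ge0 ?sqr_ge0.
  rewrite ler_pM2r ?invr_gt0// ler_ln ?posrE ?sph_gt0//.
  rewrite /sph sqr_cabs lerD2l.
  by case: nz => zr zi; rewrite lerD// -real_normK ?num_real// lerXn2r ?nnegrE.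
have zn : (n%:R < cabs z)%R.
  have h : (`|re z| <= cabs z)%R.
    by rewrite cabsE -sqrtr_sqr ler_wsqrtr// lerDl sqr_ge0.
  have k : (`|im z| <= cabs z)%R.
    by rewrite cabsE -sqrtr_sqr ler_wsqrtr// lerDr sqr_ge0.
  rewrite ltNge; apply/negP => zn; apply: nz; split.
    exact: le_trans zn.
  exact: le_trans zn.
have rn : (Num.max r 1 < cabs z)%R by exact: lt_trans (truncnS_gt _) zn.
move: rn; rewrite gt_max => /andP[rz z1].
apply: le_trans (aQ z _); last exact: rV.
have z0 : (0 < cabs z)%R by exact: lt_trans z1.
rewrite lee_fin lerBlDr -lerBlDl le_max; apply/orP; right.
rewrite lerBlDl.
rewrite (_ : a + _ + _ = t * (ln 2 / 2 + ln (cabs z)))%R; last by ring.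
rewrite ler_pM2l//.
have : (ln (sph z) <= ln (2 * cabs z ^+ 2))%R.
  rewrite ler_ln ?posrE ?sph_gt0 ?mulr_gt0 ?exprn_gt0//.
  rewrite /sph mulr_natl mulr2n lerD2r.
  by rewrite exprn_ege1// ltW.
rewrite lnM ?posrE ?exprn_gt0// lnXn// /log_sph; lra.
Qed.

End external_field.

(** * Weighted energies on the sphere *)

Section equilibrium.
Local Open Scope ereal_scope.
Context {R : realType}.
Implicit Types (mu nu sigma : fmeasC R) (x y z : Cplx R).
Variables (t : R) (Sigma : set (Cplx R)) (Q : Cplx R -> \bar R).
Hypotheses (cSigma : closed Sigma) (t0 : (0 < t)%R).

(** The external field seen from the sphere: [Q / t - log_sph], shifted by a
    constant to be nonnegative and extended by [0] outside [Sigma]. *)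
Lemma reduced_field_exists : weakly_admissible t Sigma Q ->
  exists (q : Cplx R -> \bar R) (b : R),
  [/\ measurable_fun [set: borelC R] (q : borelC R -> \bar R),
      forall z, 0 <= q z &
      forall z, Sigma z -> Q z = t%:E * q z + (t * (log_sph z - b))%:E].
Proof.
move=> waQ; have [c cQ] := weakly_admissible_lower_bound cSigma t0 waQ.
have [_ lQ _ _] := waQ.
pose q0 z := (t^-1)%:E * Q z - (log_sph z - c / t)%:E.
exists (q0 \_ Sigma), (c / t)%R; split.
- apply/(measurable_restrictT _ _).1; first exact: closed_borel.
  apply: emeasurable_funB.
    by apply: measurable_funeM; exact: lsc_measurable.
  apply/measurable_EFinP; apply: measurable_funB; last exact: measurable_cst.
  exact: measurable_funTS measurable_log_sph.
- move=> z; rewrite patchE; case: ifPn => //; rewrite inE => /cQ Qz.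
  rewrite /q0 sube_ge0//; apply: (@le_trans _ _ ((t^-1)%:E * (t * log_sph z - c)%:E)).
    rewrite -EFinM lee_fin mulrBr mulrA mulVf ?gt_eqF// mul1r.
    by rewrite (mulrC c).
  by rewrite lee_wpmul2l// lee_fin invr_ge0 ltW.
- move=> z Sz; rewrite patchE mem_set// /q0.
  move: (Q z) (log_sph z) => [r| |] l.
  + rewrite -[RHS]/(t * (t^-1 * r - (l - c / t)) + t * (l - c / t))%:E.
    by congr EFin; field; exact: lt0r_neq0.
  + by rewrite gt0_muley ?lte_fin ?invr_gt0// gt0_muley.
  + by rewrite gt0_muleNy ?lte_fin ?invr_gt0// gt0_muleNy.
Qed.

Variables (q : Cplx R -> \bar R) (b : R).
Hypothesis mq : measurable_fun [set: borelC R] (q : borelC R -> \bar R).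
Hypothesis q0 : forall z, 0 <= q z.
Hypothesis QE :
  forall z, Sigma z -> Q z = t%:E * q z + (t * (log_sph z - b))%:E.

(** Adding [log_sph] at both points turns the weighted integrand into the
    nonnegative function [spherical_kernel + q + q], up to the constant [2 b];
    the complement of [Sigma `*` Sigma] is negligible. *)
Lemma weighted_energyE sigma : mass_on t Sigma sigma ->
  weighted_energy t Sigma Q sigma = spherical_energy sigma sigma +
    (t%:E * \int[sigma]_x q x + t%:E * \int[sigma]_x q x) -
    (b * t ^+ 2 + b * t ^+ 2)%:E.
Proof.
move=> [sT suppS]; rewrite /weighted_energy.
have mS : measurable (Sigma : set (borelC R)) by exact: closed_borel.
have mSS : measurable (Sigma `*` Sigma : set (borelC R * borelC R)).
  exact: measurableX.
have mK := @measurable_spherical_kernel R.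
have mq1 : measurable_fun [set: borelC R * borelC R]
  (fun p : borelC R * borelC R => q p.1) by exact: measurableT_comp mq _.
have mq2 : measurable_fun [set: borelC R * borelC R]
  (fun p : borelC R * borelC R => q p.2) by exact: measurableT_comp mq _.
pose G (p : borelC R * borelC R) := spherical_kernel p.1 p.2 + (q p.1 + q p.2).
have mG : measurable_fun setT G.
  by apply: emeasurable_funD => //; exact: emeasurable_funD.
have G0 p : 0 <= G p.
  by apply: adde_ge0; [exact: spherical_kernel_ge0|exact: adde_ge0].
have S0 : sigma (~` Sigma) = 0 by exact: mass_off_closed.
have sS : sigma Sigma = t%:E.
  rewrite -sT -(setUv Sigma) measureU ?setICr//; last exact: measurableC.
  by rewrite [X in _ = _ + X]S0 adde0.
have sig2 : (sigma \x sigma) (Sigma `*` Sigma) = (t ^+ 2)%:E.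
  by rewrite product_measure1E// [X in X * X]sS -EFinM expr2.
have off : (sigma \x sigma) (~` (Sigma `*` Sigma)) = 0.
  have -> : ~` (Sigma `*` Sigma) = (~` Sigma `*` setT) `|` (Sigma `*` ~` Sigma).
    apply/seteqP; split => -[x y] /=.
      by move=> /not_andP; have [] := pselect (Sigma x); [right|left]; tauto.
    by tauto.
  have mSc : measurable (~` Sigma : set (borelC R)) by exact: measurableC.
  apply/eqP; rewrite -measure_le0.
  apply: le_trans (measureU2 _ _ _) _; try exact: measurableX.
  rewrite /= !product_measure1E// [X in X * _ + _]S0 [X in _ + _ * X]S0.
  by rewrite mul0e mule0 adde0.
transitivity (\int[sigma \x sigma]_(p in Sigma `*` Sigma)
    (G p - (b + b)%:E)).
  apply: eq_integral => p; rewrite inE => -[S1 S2].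
  rewrite (QE S1) (QE S2) /G /spherical_kernel.
  have dv z : (t%:E * q z + (t * (log_sph z - b))%:E) * (t^-1)%:E =
      q z + (log_sph z - b)%:E.
    move: (q0 z) (log_sph z); case: (q z) => [r| |]// _ l.
      rewrite -[LHS]/((t * r + t * (l - b)) * t^-1)%:E -[RHS]/(r + (l - b))%:E.
      by congr EFin; field; exact: lt0r_neq0.
    by rewrite gt0_muley// gt0_mulye// lte_fin invr_gt0.
  rewrite !dv; move: (- log_dist _ _) (q p.1) (q p.2) => [u| |] [v| |] [w| |]//=.
  by rewrite -!EFinD; congr EFin; ring.
have ib : (sigma \x sigma).-integrable (Sigma `*` Sigma)
    (EFin \o (fun _ : borelC R * borelC R => b + b)%R).
  apply/integrableP; split; first exact: measurable_cst.
  by rewrite integral_cst// [X in _ * X]sig2 /= -EFinM ltry.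
have [-> _] := ge0_integralB_integrable mSS (measurable_funTS mG)
  (fun p _ => G0 p) ib.
rewrite integral_cst// [X in _ - _ * X]sig2; congr (_ - _); last first.
  by rewrite -EFinM; congr EFin; ring.
transitivity (\int[sigma \x sigma]_p G p).
  rewrite (ge0_negligible_integral (measurableC mSS) measurableT mG
    (fun p _ => G0 p) off).
  by rewrite setTD setCK.
rewrite /G ge0_integralD//; last 3 first.
- by move=> p _; exact: spherical_kernel_ge0.
- by move=> p _; rewrite adde_ge0.
- exact: emeasurable_funD.
rewrite ge0_integralD// (integral_fst sigma mq)// (integral_snd sigma mq)//.
by rewrite spherical_energy_prod sT.
Qed.

Lemma potential_fieldE mu z :
  mu.-integrable setT (EFin \o log_sph : borelC R -> \bar R) ->
  mu setT = t%:E -> Sigma z ->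
  log_potential mu z + Q z = spherical_potential mu z + t%:E * q z -
    (fine (\int[mu]_y (log_sph y)%:E) + t * b)%:E.
Proof.
move=> iL muT Sz; rewrite (spherical_potentialE z iL) (QE Sz) muT /=.
move: (log_potential mu z) (t%:E * q z) (fine _) => [v| |] [w| |] l //=.
by rewrite -!EFinD; congr EFin; ring.
Qed.

End equilibrium.

(** * Comparison with the equilibrium measure *)

Section frostman.
Local Open Scope ereal_scope.
Context {R : realType}.
Implicit Types (mu nu sigma : fmeasC R) (W : Cplx R -> \bar R).

Lemma union_null sigma (A B : set (borelC R)) :
  measurable A -> measurable B -> sigma A = 0 -> sigma B = 0 ->
  sigma (A `|` B) = 0.
Proof.
move=> mA mB A0 B0; apply/eqP; rewrite -measure_le0.
have : sigma (A `|` B) <= sigma A + sigma B by exact: measureU2.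
by rewrite A0 B0 adde0.
Qed.

(** The exceptional set of capacity zero need not be Borel; the Borel set shown
    to be null is that of the points of [F] where [P] fails. *)
Lemma qe_ae sigma (F : set (Cplx R)) (P : Cplx R -> Prop) :
  closed F -> measure_support sigma `<=` F ->
  spherical_energy sigma sigma < +oo ->
  measurable (F `&` [set z | ~ P z] : set (borelC R)) ->
  quasi_everywhere F P -> {ae sigma, forall z, [set: borelC R] z -> P z}.
Proof.
move=> cF sF Efin mA [N N0 PN].
have mF := measurableC (closed_borel cF).
exists ((F `&` [set z | ~ P z]) `|` ~` F); split.
- exact: measurableU.
- apply: union_null => //; last exact: mass_off_closed.
  apply: (polar_null Efin N0 mA) => z [Fz /=]; apply: contra_notP => Nz.
  exact: PN.
- move=> z /= /not_implyP[_ nPz].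
  by have [Fz|Fz] := pselect (F z); [left|right].
Qed.

Lemma qe_ge_integral sigma W (F : set (Cplx R)) (c : R) : (0 <= c)%R ->
  measurable_fun [set: borelC R] (W : borelC R -> \bar R) ->
  (forall z, 0 <= W z) ->
  closed F -> measure_support sigma `<=` F ->
  spherical_energy sigma sigma < +oo ->
  quasi_everywhere F (fun z => c%:E <= W z) ->
  c%:E * sigma setT <= \int[sigma]_z W z.
Proof.
move=> c0 mW W0 cF sF Efin cW.
rewrite -integral_cst//; apply: ae_ge0_le_integral => //.
have mA : measurable ((F : set (borelC R)) `&` [set z | ~ c%:E <= W z]).
  rewrite (_ : [set z | ~ _] = [set z | W z < c%:E]).
    apply: emeasurable_fun_infty_o; first exact: closed_borel.
    exact: measurable_funTS.
  by apply/seteqP; split => z /=; rewrite ltNge => /negP.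
exact: (qe_ae cF sF Efin mA cW).
Qed.

Lemma qe_le_integral sigma W (c : R) : (0 <= c)%R ->
  measurable_fun [set: borelC R] (W : borelC R -> \bar R) ->
  (forall z, 0 <= W z) ->
  spherical_energy sigma sigma < +oo ->
  quasi_everywhere (measure_support sigma) (fun z => W z <= c%:E) ->
  \int[sigma]_z W z <= c%:E * sigma setT.
Proof.
move=> c0 mW W0 Efin Wc; have cF := @closed_support R sigma.
rewrite -integral_cst//; apply: ae_ge0_le_integral => //.
have mA : measurable ((measure_support sigma : set (borelC R)) `&`
    [set z | ~ W z <= c%:E]).
  rewrite (_ : [set z | ~ _] = [set z | c%:E < W z]).
    apply: emeasurable_fun_o_infty; first exact: closed_borel.
    exact: measurable_funTS.
  by apply/seteqP; split => z /=; rewrite ltNge => /negP.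
exact: (qe_ae cF (@subset_refl _ _) Efin mA Wc).
Qed.

End frostman.

Theorem proposition4p8 (R : realType) (Sigma : set (Cplx R)) (t : R)
    (Q : Cplx R -> \bar R) (muQ mu : fmeasC R) (C : R) :
  closed Sigma -> ~ bounded_set Sigma ->
  0 < t ->
  weakly_admissible t Sigma Q ->
  equilibrium_measure t Sigma Q muQ ->
  mass_on t Sigma mu ->
  log_energy mu \is a fin_num ->
  quasi_everywhere Sigma (fun z => (C%:E <= log_potential mu z + Q z)%E) ->
  quasi_everywhere (measure_support mu)
    (fun z => (log_potential mu z + Q z <= C%:E)%E) ->
  same_measure mu muQ.
Proof.
move=> cSigma _ t0 waQ [_ uniqQ] massmu Ifin [N1 N10 lowN1] [N2 N20 upN2].
apply: uniqQ; split=> // sigma masssigma.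
have [q [b [mq q0 QE]]] := reduced_field_exists cSigma t0 waQ.
have [muT musupp] := massmu; have [sigmaT sigmasupp] := masssigma.
have muT0 : (0 < mu setT)%E by rewrite muT lte_fin.
have iL := log_sph_integrable Ifin muT0.
have Emu := spherical_energy_ltoo Ifin muT0.
rewrite (weighted_energyE cSigma t0 mq q0 QE massmu).
rewrite (weighted_energyE cSigma t0 mq q0 QE masssigma) leeD2r//.
pose l := fine (\int[mu]_y (log_sph y)%:E).
pose W z : \bar R := (spherical_potential mu z + t%:E * q z)%E.
have tq0 z : (0 <= t%:E * q z)%E by rewrite mule_ge0// lee_fin ltW.
have mtq : measurable_fun [set: borelC R]
  (fun z : borelC R => t%:E * q z)%E by exact: measurable_funeM.
have mU := measurable_spherical_potential mu.
have U0 := spherical_potential_ge0 mu.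
have W0 z : (0 <= W z)%E by exact: adde_ge0.
have mW : measurable_fun [set: borelC R] (W : borelC R -> \bar R).
  exact: emeasurable_funD.
have VQ z : Sigma z -> (log_potential mu z + Q z = W z - (l + t * b)%:E)%E.
  exact: potential_fieldE.
(* The maximum with 0 keeps both integral comparisons between nonnegative
   functions; it costs nothing since W is nonnegative. *)
pose c := Num.max (C + (l + t * b)) 0.
have c0 : 0 <= c by rewrite le_max lexx orbT.
have intW (m : fmeasC R) : (\int[m]_z W z =
    spherical_energy m mu + t%:E * \int[m]_z q z)%E.
  by rewrite ge0_integralD// ge0_integralZl_EFin// ltW.
have q0i (m : fmeasC R) : (0 <= t%:E * \int[m]_z q z)%E.
  by apply: mule_ge0; [rewrite lee_fin ltW|exact: integral_ge0].
have up : (spherical_energy mu mu + t%:E * \int[mu]_z q z <= c%:E * t%:E)%E.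
  rewrite -intW -muT; apply: qe_le_integral => //.
  exists N2 => // z zmu Nz; have := upN2 z zmu Nz.
  rewrite (VQ _ (musupp z zmu)) leeBlDr// -EFinD => /le_trans; apply.
  by rewrite lee_fin le_max lexx.
have low : (spherical_energy sigma sigma < +oo)%E ->
    (c%:E * t%:E <= spherical_energy sigma mu + t%:E * \int[sigma]_z q z)%E.
  move=> Esigma; rewrite -intW -sigmaT; apply: (@qe_ge_integral _ _ _ Sigma) => //.
  exists N1 => // z zS Nz; have := lowN1 z zS Nz.
  rewrite (VQ _ zS) leeBrDr// -EFinD => CW.
  by rewrite EFin_max ge_max CW W0.
have [Eoo|Efin] := eqVneq (spherical_energy sigma sigma) +oo%E.
  rewrite Eoo addye ?leey// gt_eqF// (lt_le_trans (ltNyr 0))// adde_ge0//.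
rewrite -ltey in Efin; have {}low := low Efin.
have psd := spherical_energy_le mu sigma.
have E0 := @spherical_energy_ge0 R.
have := E0 mu mu; have := E0 sigma sigma; have := E0 sigma mu.
move: psd low up Emu Efin (q0i mu) (q0i sigma).
case: (spherical_energy mu mu) => [emm| |]//.
case: (spherical_energy sigma sigma) => [ess| |]//.
case: (spherical_energy sigma mu) => [esm| |]//.
case: (t%:E * \int[sigma]_z q z)%E => [qs| |]//; last by move=> *; rewrite leey.
case: (t%:E * \int[mu]_z q z)%E => [qm| |]//.
rewrite -!EFinD -EFinM !lee_fin; lra.
Qed.
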